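(* Let $d\geq 1$, let $F\subseteq\mathbb{Z}^d$ be a finite configuration of $|F|=k\geq 3$ points, and let $\mu\in(0,\frac{k-1}{k})$ be real. Then there is a set of lattice points $X\subseteq\mathbb{N}^d$ such that (i) for every $r\geq 1$, every colouring of $X$ with $r$ colours contains a monochromatic homothetic copy of $F$, and (ii) every finite subset $Y\subseteq X$ has an $F$-free subset $Z\subseteq Y$ of size $|Z|\geq\mu|Y|$.
   Context: A homothetic copy of $F$ is a set $v+\lambda F=\{v+\lambda f\colon f\in F\}$ with $v\in\mathbb{Z}^d$ and $\lambda$ a positive integer. A set $Z\subseteq\mathbb{Z}^d$ is called $F$-free if there is no nonzero real number $\lambda$ such that $Z$ contains a congruent copy of $\lambda F$, i.e. a subset that is the image of $\lambda F=\{\lambda f\colon f\in F\}$ under an isometry of Euclidean space $\mathbb{R}^d$. *)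

(* Defs.v *)
From HB Require Import structures.
From mathcomp Require Import all_boot all_order all_algebra.
From mathcomp Require Import reals.
Set Implicit Arguments. Unset Strict Implicit. Unset Printing Implicit Defensive.
Import Order.TTheory GRing.Theory Num.Theory.
Local Open Scope ring_scope.

Definition lpt (d : nat) := 'rV[int]_d.

Definition embed (R : realType) (d : nat) (x : lpt d) : 'rV[R]_d :=
  map_mx (fun z : int => z%:~R) x.

Definition sqdist (R : realType) (d : nat) (x y : 'rV[R]_d) : R :=
  \sum_(i < d) (x 0 i - y 0 i) ^+ 2.

Definition isometry (R : realType) (d : nat) (g : 'rV[R]_d -> 'rV[R]_d) :=
  forall x y, sqdist (g x) (g y) = sqdist x y.

Definition F_free (R : realType) (d : nat) (F : seq (lpt d)) (Z : seq (lpt d)) :=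
  ~ (exists (lam : R) (g : 'rV[R]_d -> 'rV[R]_d),
        lam != 0 /\ isometry g /\
        forall f, f \in F -> exists2 z, z \in Z & embed R z = g (lam *: embed R f)).

Definition mono_homothetic_copy (d r : nat) (F : seq (lpt d))
    (X : lpt d -> Prop) (c : lpt d -> 'I_r) :=
  exists (v : lpt d) (lam : nat) (col : 'I_r),
    (0 < lam)%N /\
    forall f, f \in F -> X (v + (lam%:Z) *: f) /\ c (v + (lam%:Z) *: f) = col.

(* Main.v *)
(** The points of [X] are built by the partite construction over a [k]-uniform linear
    hypergraph [H] which is not [r]-colourable although its vertices carry a probability
    distribution on independent sets hitting every vertex with probability at least [mu].
    The edges of [H] come from increasing sequences [u] of length [width]: the [s]-th
    vertex drops [s] early and [k - 1 - s] late entries of [u], so that a middle entry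
    moves down by [s] places.  Ramsey's theorem makes [H] non-[r]-colourable; a random
    order of the ground set, together with the rule "the position of the minimum is a
    middle one and not divisible by [k]", yields the independent sets.

    The partite construction starts from disjoint lines over the edges of [H] and
    amalgamates along one vertex of [H] after the other by the Hales-Jewett theorem.
    Quasilines (families that are constant or injective in every coordinate) must keep
    projecting onto edges.  The only obstruction would be three Hales-Jewett lines whose
    active sets satisfy [A2 = A0 + A1] (disjoint union); Shelah's proof of the
    Hales-Jewett theorem can be run so that no such triple occurs.

    Finally the words are mapped to the lattice by [x |-> sum_i q_i f_(x_i)] with rapidly
    growing weights, so that every similar copy of [F] comes from a quasiline, and the
    finite sets obtained for [r = 1, 2, ...] are placed extremely far apart; as [F] has
    at least three points, no similar copy of [F] meets two of them. *)
Require Import Defs.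
From HB Require Import structures.
From mathcomp Require Import all_boot all_order all_algebra all_fingroup.
From mathcomp Require Import reals.
From mathcomp Require Import boolp.
From mathcomp Require Import zify ring.
Set Implicit Arguments. Unset Strict Implicit. Unset Printing Implicit Defensive.
Import Order.TTheory GRing.Theory Num.Theory.
Local Open Scope nat_scope.

(** * A union-free Hales-Jewett theorem *)

(** Pigeonhole on the sets [S x] of colours seen to the right of [x]: if [S x1 = S x2] with
    [x1 < x2], the colour of the pair [(x1, x2)] recurs on a pair starting at [x2]. This is the
    unbounded chromatic number of shift graphs. *)
Lemma shift_pair_ramsey (C : finType) :
  exists n, forall g : nat -> nat -> C,
    exists x y z, [/\ x < y, y < z, z < n & g x y = g y z].
Proof.
exists (#|{set C}|.+2) => g.
pose n := #|{set C}|.+2.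
pose S (x : 'I_#|{set C}|.+1) := [set g x y | y : 'I_n & x < y].
have : ~~ injectiveb S.
  by apply/negP => /injectiveP /leq_card; rewrite card_ord ltnn.
move=> /injectivePn [x1 [x2 nx12 eS]].
wlog lt12 : x1 x2 nx12 eS / x1 < x2.
  move=> H; case: (ltngtP x1 x2) => h; first exact: (H x1 x2).
    by apply: (H x2 x1) => //; rewrite eq_sym.
  by move/eqP: nx12; case; apply: val_inj.
have lt2n : x2 < n by rewrite /n; have := ltn_ord x2; lia.
have : g x1 x2 \in S x1 by apply/imsetP; exists (Ordinal lt2n); rewrite ?inE.
rewrite eS => /imsetP [z]; rewrite inE => lt2z e.
by exists x1, x2, z.
Qed.

(** A partial word [t] encodes a combinatorial line or subspace, with [None] at its variable
    coordinates. The filling [w] may depend on the coordinate, as Shelah's blocks require. *)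
Definition fill (J T : finType) (t : J -> option T) (w : J -> T) : {ffun J -> T} :=
  [ffun j => odflt (w j) (t j)].

Definition active (J T : Type) (t : J -> option T) (j : J) : bool := ~~ isSome (t j).

Definition disjoint_union (J : Type) (A0 A1 A2 : J -> bool) :=
  forall j, ~~ (A0 j && A1 j) /\ A2 j = A0 j || A1 j.

(** All the inequalities come from testing the pointwise hypothesis at the ends of the three
    half-open intervals. *)
Lemma adjacent_intervals N s0 e0 s1 e1 s2 e2 :
  s0 < e0 -> s1 < e1 -> s2 < e2 -> e0 < N -> e1 < N -> e2 < N -> s0 <= s1 ->
  (forall p, p < N -> ~~ ((s0 <= p < e0) && (s1 <= p < e1)) /\
     (s2 <= p < e2) = (s0 <= p < e0) || (s1 <= p < e1)) ->
  [/\ s2 = s0, e0 = s1 & e1 = e2].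
Proof.
move=> i0 i1 i2 u0 u1 u2 le H.
have le01 : e0 <= s1 by have [H1 _] := H s1 ltac:(lia); lia.
have le20 : s2 <= s0 by have [_ H1] := H s0 ltac:(lia); lia.
have le02 : s0 <= s2 by have [_ H1] := H s2 ltac:(lia); lia.
have le12 : e1 <= e2 by have [_ H1] := H e1.-1 ltac:(lia); lia.
have le10 : s1 <= e0 by have [_ H1] := H e0 ltac:(lia); lia.
have le21 : e2 <= e1 by have [_ H1] := H e2.-1 ltac:(lia); lia.
by split; apply/eqP; rewrite eqn_leq ?le01 ?le02 ?le12 ?le20 ?le10 ?le21.
Qed.

(** With [x * n + y] as code of the pair [(x, y)], adjacency of the intervals yields [y2 = y0],
    [z0 = y1] and [y1 = y2], hence [y0 = z0], against [y0 < z0]. *)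
Lemma interval_shift_no_union n x0 y0 z0 x1 y1 z1 x2 y2 z2 :
  x0 < y0 -> y0 < z0 -> z0 < n -> x1 < y1 -> y1 < z1 -> z1 < n ->
  x2 < y2 -> y2 < z2 -> z2 < n ->
  ~ (forall p, p < n * n ->
      ~~ ((x0 * n + y0 <= p < y0 * n + z0) && (x1 * n + y1 <= p < y1 * n + z1)) /\
      (x2 * n + y2 <= p < y2 * n + z2) =
      (x0 * n + y0 <= p < y0 * n + z0) || (x1 * n + y1 <= p < y1 * n + z1)).
Proof.
have key a0 b0 a1 b1 : b0 < n -> b1 < n -> a0 * n + b0 = a1 * n + b1 ->
    a0 = a1 /\ b0 = b1.
  move=> l0 l1 e; have n0 : 0 < n by apply: leq_ltn_trans l0.
  have := congr1 (divn^~ n) e; have := congr1 (modn^~ n) e.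
  by rewrite !modnMDl !divnMDl // !modn_small // !divn_small // !addn0 => -> ->.
wlog le01 : x0 y0 z0 x1 y1 z1 / x0 * n + y0 <= x1 * n + y1.
  move=> W a b c a1 b1 c1 a2 b2 c2 H.
  have [h|h] := leqP (x0 * n + y0) (x1 * n + y1).
    exact: (W x0 y0 z0 x1 y1 z1).
  apply: (W x1 y1 z1 x0 y0 z0) => //; first exact: ltnW.
  by move=> p /H; rewrite andbC orbC.
move=> a0 b0 c0 a1 b1 c1 a2 b2 c2 H.
have bnd a b : a < b -> b < n -> a * n + b < n * n by clear; nia.
have inc a b c : a < b -> b < c -> c < n -> a * n + b < b * n + c by clear; nia.
have [E1 E2 E3] := adjacent_intervals (inc _ _ _ a0 b0 c0) (inc _ _ _ a1 b1 c1)
  (inc _ _ _ a2 b2 c2) (bnd _ _ b0 c0) (bnd _ _ b1 c1) (bnd _ _ b2 c2) le01 H.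
have [_ e1] := key _ _ _ _ (ltn_trans b2 c2) (ltn_trans b0 c0) E1.
have [_ e2] := key _ _ _ _ c0 (ltn_trans b1 c1) E2.
have [e3 _] := key _ _ _ _ c1 c2 E3.
by move: b0; rewrite e2 e3 e1 ltnn.
Qed.

(* Shelah's fusion of the letters [u] and [v], one block per element of [bs]. The
   usual pigeonhole in each block is replaced by the chromatic number of the shift
   graph: the active interval of a block is [m(x,y), m(y,z)), and no two such
   intervals are adjacent with a union of the same form. *)
Lemma shelah_blocks (T : finType) (u v : T) (B : eqType) (bs : seq B) (C : finType) :
  uniq bs ->
  exists (J : finType) (beta : J -> B) (Fam : (J -> option T) -> Prop),
  [/\ forall j, beta j \in bs,
      forall t, Fam t -> forall j, t j \in [:: None; Some u; Some v],
      forall t, Fam t -> forall b, b \in bs -> exists2 j, beta j = b & active t j,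
      forall t0 t1 t2, Fam t0 -> Fam t1 -> Fam t2 -> forall b, b \in bs ->
        ~ (forall j, beta j = b ->
             ~~ (active t0 j && active t1 j) /\ active t2 j = active t0 j || active t1 j) &
      forall c : {ffun J -> T} -> C, exists2 t, Fam t &
        forall w w' : B -> T,
          (forall b, b \in bs -> w b = w' b \/ w b = u /\ w' b = v) ->
          c (fill t (w \o beta)) = c (fill t (w' \o beta))].
Proof.
elim: bs C => [|b bs IH] C /=.
  move=> _; exists void, (fun x : void => match x with end), (fun _ => True).
  split=> //; try by case.
  move=> c; exists (fun=> None) => // w w' _; congr (c _); apply/ffunP; by case.
case/andP=> nb ubs.
(* A word on the earlier blocks is coloured by its results for all letters of the new block [b], so
   that the induction hypothesis applies whatever letter [b] receives. *)
have [J [beta [Fam [h1 h2 h3 h4 h5]]]] := IH {ffun T -> C} ubs.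
have [n shift] := shift_pair_ramsey {ffun {ffun J -> T} -> C}.
pose J' := (J + 'I_(n * n))%type.
pose beta' (j : J') := match j with inl j => beta j | inr _ => b end.
(* Filled with [u], this pattern is the step word switching from [u] to [v] at [y * n + z]; filled
   with [v], it switches at [x * n + y]. The triple provided by [shift] gives both step words the
   same colour. *)
pose tau x y z p : option T := if p < x * n + y then Some u
                  else if p < y * n + z then None else Some v.
pose glue t (f : nat -> option T) : J' -> option T :=
  fun j => match j with inl j => t j | inr p => f p end.
pose Fam' (t : J' -> option T) := exists2 t0, Fam t0 &
   exists x y z, [/\ x < y, y < z, z < n & t = glue t0 (tau x y z)].
have inc a b0 c : a < b0 -> b0 < c -> c < n -> a * n + b0 < b0 * n + c by clear; nia.
have bnd a b0 : a < n -> b0 < n -> a * n + b0 < n * n by clear; nia.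
exists J', beta', Fam'; split.
- by case=> [j|p]; rewrite inE /= ?eqxx // h1 orbT.
- move=> t [t0 F0 [x [y [z [xy yz zn ->]]]]] [j|p] /=; first exact: h2.
  by rewrite /tau !inE; case: ifP => _; [|case: ifP => _]; rewrite ?eqxx ?orbT.
- move=> t [t0 F0 [x [y [z [xy yz zn ->]]]]] b'; rewrite inE => /orP[/eqP->|b'bs].
    have lt : x * n + y < n * n by apply: bnd; lia.
    exists (inr (Ordinal lt)) => //; rewrite /active /= /tau ltnn.
    by rewrite inc.
  by have [j ej aj] := h3 _ F0 _ b'bs; exists (inl j).
- move=> _ _ _ [t0 F0 [x0 [y0 [z0 [xy0 yz0 zn0 ->]]]]] 
    [t1 F1 [x1 [y1 [z1 [xy1 yz1 zn1 ->]]]]] [t2 F2 [x2 [y2 [z2 [xy2 yz2 zn2 ->]]]]] b'.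
  rewrite inE => /orP[/eqP->|b'bs] H; last first.
    by apply: (h4 _ _ _ F0 F1 F2 _ b'bs) => j ej; apply: (H (inl j)).
  apply: (interval_shift_no_union xy0 yz0 zn0 xy1 yz1 zn1 xy2 yz2 zn2) => p ltp.
  have := H (inr (Ordinal ltp)) erefl; rewrite /active /=.
  have e x y z : ~~ isSome (tau x y z p) = (x * n + y <= p < y * n + z).
    rewrite /tau (leqNgt (x * n + y) p).
    by case: (p < x * n + y) => //=; case: (p < _).
  by rewrite !e.
- move=> c.
  pose join (f : {ffun J -> T}) (g : nat -> T) : {ffun J' -> T} :=
    [ffun j : J' => match j with inl j => f j | inr p => g p end].
  pose stp m (p : nat) := if p < m then u else v.
  have [x [y [z [xy yz zn eg]]]] :=
    shift (fun x y => [ffun f => c (join f (stp (x * n + y)))]).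
  pose tl l p := odflt l (tau x y z p).
  have [t0 F0 Ht0] := h5 (fun f => [ffun l => c (join f (tl l))]).
  exists (glue t0 (tau x y z)); first by exists t0 => //; exists x, y, z.
  move=> w w' ww'.
  have E (w0 : B -> T) : fill (glue t0 (tau x y z)) (w0 \o beta') =
             join (fill t0 (w0 \o beta)) (tl (w0 b)).
    by apply/ffunP => -[j|p]; rewrite !ffunE //= ffunE.
  rewrite !E.
  have := Ht0 w w' (fun b' hb' => ww' b' (mem_behead (s:=b::bs) hb')).
  move=> /ffunP /(_ (w b)); rewrite !ffunE => ->.
  have [->//|[-> ->]] := ww' b (mem_head _ _).
  move/ffunP/(_ (fill t0 (w' \o beta))): eg; rewrite !ffunE => eg.
  transitivity (c (join (fill t0 (w' \o beta)) (stp (y * n + z)))).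
    congr (c _); apply/ffunP => -[j|p]; rewrite !ffunE // /tl /tau /stp.
    have := inc _ _ _ xy yz zn; case: ifP => //= h; last by case: ifP.
    by move=> h'; rewrite (ltn_trans h h').
  rewrite -eg; congr (c _); apply/ffunP => -[j|p]; rewrite !ffunE // /tl /tau /stp.
  by case: ifP => //; case: ifP.
Qed.

Definition union_free_HJ (T C : finType) (ls : seq T) :=
  exists (J : finType) (Lines : (J -> option T) -> Prop),
  [/\ forall L, Lines L -> forall j y, L j = Some y -> y \in ls,
      forall L, Lines L -> exists j, active L j,
      forall L0 L1 L2, Lines L0 -> Lines L1 -> Lines L2 ->
        ~ disjoint_union (active L0) (active L1) (active L2) &
      forall c : {ffun J -> T} -> C, exists2 L, Lines L &
        forall y y', y \in ls -> y' \in ls ->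
          c (fill L (fun=> y)) = c (fill L (fun=> y'))].

(** Induction on the alphabet: a line over the shorter alphabet is composed with a pattern from
    [shelah_blocks], one block per coordinate, which makes [v] interchangeable with [u]. In a
    forbidden triple of composed lines, a block active in both summands contradicts the block
    property of the patterns; without such a block the triple descends to the shorter alphabet. *)
Lemma hales_jewett_union_free (T C : finType) (ls : seq T) : union_free_HJ C ls.
Proof.
have base ls' : size ls' <= 1 -> union_free_HJ C ls'.
  move=> sz; exists unit, (fun L => L = (fun=> None)); split.
  - by move=> L -> j y.
  - by move=> L ->; exists tt.
  - by move=> L0 L1 L2 -> -> -> /(_ tt) [].
  - move=> c; exists (fun=> None) => // y y'.
    by case: ls' sz => [|a [|b l]] //= _; rewrite !inE => /eqP-> /eqP->.
elim: ls => [|v [|u ls] IH]; [exact: base|exact: base|].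
have [J0 [Lines0 [l1 l2 l3 l4]]] := IH.
have [J [beta [Fam [h1 h2 h3 h4 h5]]]] :=
  shelah_blocks u v C (enum_uniq J0).
have inJ0 b : b \in enum J0 by rewrite mem_enum.
pose cmp (L : J0 -> option T) (t : J -> option T) j :=
  if t j is Some y then Some y else L (beta j).
have act_cmp L t j : active (cmp L t) j = active t j && active L (beta j).
  by rewrite /active /cmp; case: (t j).
exists J, (fun L' => exists L t, [/\ Lines0 L, Fam t & L' = cmp L t]); split.
- move=> _ [L [t [lL Ft ->]]] j y; rewrite /cmp; have := h2 _ Ft j.
  case: (t j) => [y' h [<-]|_ /(l1 _ lL)].
    by move: h; rewrite !inE /= => /orP[] /eqP [->]; rewrite eqxx ?orbT.
  by rewrite !inE => ->; rewrite orbT.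
- move=> _ [L [t [lL Ft ->]]]; have [b ab] := l2 _ lL.
  by have [j ej aj] := h3 _ Ft _ (inJ0 b); exists j; rewrite act_cmp aj ej.
- move=> _ _ _ [L0 [t0 [lL0 F0 ->]]] [L1 [t1 [lL1 F1 ->]]] [L2 [t2 [lL2 F2 ->]]] H.
  apply: (l3 _ _ _ lL0 lL1 lL2) => b.
  have U : active L2 b = active L0 b || active L1 b.
    apply/idP/idP => [a2|].
      have [j ej aj] := h3 _ F2 _ (inJ0 b).
      have [_] := H j; rewrite !act_cmp ej aj a2 /= => /esym.
      by case: (active L0 b); case: (active L1 b); rewrite ?orbT ?andbF.
    case/orP => a.
      have [j ej aj] := h3 _ F0 _ (inJ0 b).
      by have [_] := H j; rewrite !act_cmp ej aj a /=; case/andP.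
    have [j ej aj] := h3 _ F1 _ (inJ0 b).
    by have [_] := H j; rewrite !act_cmp ej aj a /= orbT; case/andP.
  split=> //; apply/negP => /andP[a0 a1].
  apply: (h4 _ _ _ F0 F1 F2 _ (inJ0 b)) => j ej.
  by have := H j; rewrite !act_cmp ej a0 a1 U a0 !andbT.
- move=> c; have [t Ft Ht] := h5 c.
  have [L lL HL] := l4 (fun w => c (fill t (w \o beta))).
  have E y : fill (cmp L t) (fun=> y) = fill t (fill L (fun=> y) \o beta).
    by apply/ffunP => j; rewrite !ffunE /cmp; case: (t j) => //=; rewrite ffunE.
  exists (cmp L t); first by exists L, t.
  have HL' y : y \in v :: u :: ls ->
    c (fill (cmp L t) (fun=> y)) = c (fill (cmp L t) (fun=> u)).
    rewrite inE => /orP[/eqP->|yl]; last by rewrite !E; apply: HL; rewrite ?mem_head.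
    apply/esym; rewrite !E; apply: Ht => b _; rewrite !ffunE.
    by case: (L b) => /=; [left|right].
  by move=> y y' /HL' -> /HL' ->.
Qed.

(** * Ramsey's theorem and random orders *)

Lemma sum_count_color (T : Type) (C : finType) (g : T -> C) (t : seq T) :
  \sum_(a : C) count (fun x => g x == a) t = size t.
Proof.
elim: t => [|x t IH] /=; first by rewrite big1.
rewrite big_split /= IH (bigD1 (g x)) //= eqxx big1 ?addn0 //.
by move=> a; rewrite eq_sym => /negbTE ->.
Qed.

(** Sets are represented by subsequences of a duplicate-free sequence. In the step to [m.+1],
    iterating the case [m] gives a long sequence on which the colour depends only on the first
    element chosen; pigeonhole on that element finishes. *)
Lemma finite_ramsey (C : finType) (m M : nat) :
  exists n, forall (T : eqType) (s : seq T) (c : seq T -> C), uniq s -> n <= size s ->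
    exists t, [/\ subseq t s, size t = M &
      forall a b, subseq a t -> subseq b t -> size a = m -> size b = m -> c a = c b].
Proof.
elim: m M => [|m IH] M.
  exists M => T s c _ le; exists (take M s); split; rewrite ?take_subseq ?size_takel //.
  by move=> a b _ _ /size0nil -> /size0nil ->.
have end_homogeneous L : exists n, forall (T : eqType) (s : seq T) (c : seq T -> C),
    uniq s -> n <= size s -> exists t (g : T -> C), [/\ subseq t s, size t = L &
      forall x a, subseq (x :: a) t -> size a = m -> c (x :: a) = g x].
  elim: L => [|L [nL HL]].
    exists 0 => T s c _ _; exists [::], (fun x => c [:: x]).
    by split; rewrite ?sub0seq.
  have [n Hn] := IH nL; exists n.+1 => T [|x s] c //= /andP[nx us] le.
  have [t1 [st1 sz1 h1]] := Hn T s (fun a => c (x :: a)) us le.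
  have [t2 [g [st2 sz2 h2]]] := HL T t1 c (subseq_uniq st1 us) (eq_leq (esym sz1)).
  (* The colour attached to [x] is read off one sample, [take m t1]; every subsequence of [t1] of
     size [m] gives the same value. *)
  exists (x :: t2), (fun y => if y == x then c (x :: take m t1) else g y).
  split; rewrite /= ?eqxx ?sz2 ?(subseq_trans st2) //.
  move=> y a; case: eqP => [-> sa sz|_ sa sz]; last exact: h2.
  have sa1 := subseq_trans sa st2.
  apply: h1; rewrite ?take_subseq // size_takel // -sz; exact: size_subseq.
(* With more than [#|C| * M] elements, some value of [g] is taken at least [M] times. *)
have [n Hn] := end_homogeneous (#|C| * M).+1; exists n => T s c us le.
have [t [g [st sz h]]] := Hn T s c us le.
have [a leM] : exists a, M <= count (fun x => g x == a) t.
  apply/existsP; rewrite -[X in is_true X]negbK negb_exists; apply/negP => /forallP H.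
  have : size t <= #|C| * M.
    rewrite -(sum_count_color g) -sum_nat_const; apply: leq_sum => a _.
    by apply: ltnW; rewrite ltnNge H.
  by rewrite sz ltnn.
pose t' := [seq x <- t | g x == a].
exists (take M t'); split.
- exact: subseq_trans (take_subseq _ _) (subseq_trans (filter_subseq _ _) st).
- by rewrite size_takel // size_filter.
have {}h b : subseq b (take M t') -> size b = m.+1 -> c b = a.
  move=> sb; have sb' := subseq_trans sb (take_subseq _ _).
  case: b {sb} sb' => // x b sb [szb]; rewrite (h x b) //.
    by have := mem_subseq sb (mem_head x b); rewrite mem_filter => /andP[/eqP].
  exact: subseq_trans sb (filter_subseq _ _).
by move=> b b' sb sb' e e'; rewrite !h.
Qed.

(** * Positions in a finite set and increasing sequences *)

Definition position n (S : {set 'I_n}) (x : 'I_n) := #|[set y in S | y < x]|.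

Lemma position_lt n (S : {set 'I_n}) (x y : 'I_n) : x \in S -> x < y -> position S x < position S y.
Proof.
move=> xS xy; apply/proper_card/properP; split.
  by apply/subsetP => z; rewrite !inE => /andP[-> /ltn_trans]; apply.
by exists x; rewrite !inE ?xS ?ltnn.
Qed.

Lemma position_inj n (S : {set 'I_n}) : {in S &, injective (position S)}.
Proof.
move=> x y xS yS e; case: (ltngtP x y) => [lt|lt|]; last exact: val_inj.
  by have := position_lt xS lt; rewrite e ltnn.
by have := position_lt yS lt; rewrite e ltnn.
Qed.

Lemma position_ub n (S : {set 'I_n}) x : x \in S -> position S x < #|S|.
Proof.
move=> xS; apply/proper_card/properP; split.
  by apply/subsetP => z; rewrite inE => /andP[].
by exists x; rewrite // !inE ltnn andbF.
Qed.

Lemma card_position n (S : {set 'I_n}) (P : pred nat) :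
  #|[set p : 'I_#|S| | P p]| <= #|[set x in S | P (position S x)]|.
Proof.
case: (posnP #|S|) => [S0|Spos].
  by rewrite [X in X <= _]eq_card0 // => p; exfalso; have := ltn_ord p; rewrite [X in _ < X]S0.
pose f (x : 'I_n) : 'I_#|S| := insubd (Ordinal Spos) (position S x).
have vf x : x \in S -> f x = position S x :> nat.
  by move=> xS; rewrite val_insubd position_ub.
have fI : {in S &, injective f}.
  by move=> x y xS yS /(congr1 val); rewrite /= !vf // => /position_inj ->.
have fS : f @: S = setT.
  by apply/eqP; rewrite eqEcard subsetT cardsT card_ord (card_in_imset fI) /=.
apply: leq_trans (leq_imset_card f _); apply: subset_leq_card.
apply/subsetP => p; rewrite inE => Pp.
have : p \in f @: S by rewrite fS inE.
case/imsetP => x xS e; apply/imsetP; exists x => //.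
by rewrite inE xS -vf // -e.
Qed.

Definition increasing M n (u : {ffun 'I_M -> 'I_n}) :=
  [forall p : 'I_M, forall q : 'I_M, (p < q) ==> (u p < u q)].

Lemma increasingP M n (u : {ffun 'I_M -> 'I_n}) :
  reflect (forall p q : 'I_M, p < q -> u p < u q) (increasing u).
Proof.
apply: (iffP forallP) => [H p q pq|H p].
  by have /forallP/(_ q)/implyP := H p; apply.
by apply/forallP => q; apply/implyP; apply: H.
Qed.

Section Increasing.
Variables (M n : nat) (u : {ffun 'I_M -> 'I_n}).
Hypothesis incu : increasing u.

Lemma increasing_mono (p q : 'I_M) : (u p < u q) = (p < q).
Proof.
have H := increasingP _ incu; case: (ltngtP p q) => pq.
- exact: H.
- by apply/negbTE; rewrite -leqNgt ltnW // H.
- by rewrite (val_inj pq) ltnn.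
Qed.

Lemma increasing_inj : injective u.
Proof.
move=> p q e; case: (ltngtP p q) => [lt|lt|]; last exact: val_inj.
  by move: lt; rewrite -increasing_mono e ltnn.
by move: lt; rewrite -increasing_mono e ltnn.
Qed.

Lemma position_imset (A : {set 'I_M}) (p : 'I_M) :
  position (u @: A) (u p) = #|[set q in A | q < p]|.
Proof.
rewrite /position -(card_imset _ increasing_inj); congr #|pred_of_set _|.
apply/setP => y; rewrite inE; apply/andP/imsetP.
  by case=> /imsetP[q qA ->]; rewrite increasing_mono => qp; exists q; rewrite // inE qA.
by case=> q; rewrite inE => /andP[qA qp ->]; rewrite increasing_mono imset_f.
Qed.

End Increasing.

Lemma card_ord_lt M (p : 'I_M) : #|[set q : 'I_M | q < p]| = p.
Proof.
have wI : injective (widen_ord (ltnW (ltn_ord p))).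
  by move=> a b /(congr1 val) /= /val_inj.
rewrite -[RHS]card_ord -cardsT -(card_imset _ wI).
congr #|pred_of_set _|; apply/setP => q; rewrite inE; apply/idP/imsetP => [qp|[i _ ->]].
  by exists (Ordinal qp) => //; apply: val_inj.
exact: (ltn_ord i).
Qed.

(** The value [u p] is recovered as the element of position [p] in the range. *)
Lemma increasing_range_inj M n (u u' : {ffun 'I_M -> 'I_n}) :
  increasing u -> increasing u' -> u @: setT = u' @: setT -> u = u'.
Proof.
move=> iu iu' e; apply/ffunP => p.
have E (v : {ffun 'I_M -> 'I_n}) : increasing v -> position (v @: setT) (v p) = p.
  move=> iv; rewrite position_imset // -[RHS]card_ord_lt.
  by apply: eq_card => q; rewrite !inE.
apply: (@position_inj _ (u @: setT)); rewrite ?E // ?imset_f ?inE //.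
  by rewrite e imset_f ?inE.
by rewrite e E.
Qed.

(** * The minimum of a set under a random order *)

Section ArgMin.
Variables (n : nat) (S : {set 'I_n}).
Implicit Type sg : 'S_n.

Definition argmin_of sg x := (x \in S) && [forall y in S, sg x <= sg y].

Lemma argmin_of_uniq sg x y : argmin_of sg x -> argmin_of sg y -> x = y.
Proof.
case/andP=> xS /forall_inP hx /andP[yS /forall_inP hy].
by apply/(@perm_inj _ sg)/val_inj/eqP; rewrite eqn_leq hx ?hy.
Qed.

(** Composition with the transposition of [x] and [y] turns an order minimal at [x] into one minimal
    at [y]. *)
Lemma card_argmin_of x y : x \in S -> y \in S ->
  #|[set sg | argmin_of sg x]| = #|[set sg | argmin_of sg y]|.
Proof.
wlog suff H : x y / x \in S -> y \in S ->
    #|[set sg | argmin_of sg x]| <= #|[set sg | argmin_of sg y]|.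
  by move=> xS yS; apply/eqP; rewrite eqn_leq !H.
move=> xS yS; rewrite -(card_imset _ (mulgI (tperm x y))).
apply: subset_leq_card; apply/subsetP => _ /imsetP[sg + ->].
rewrite !inE => /andP[_ /forall_inP hx]; rewrite /argmin_of yS /=.
apply/forall_inP => z zS; rewrite !permM tpermR; apply: hx.
by case: tpermP.
Qed.

(** Each order has exactly one minimum in [S], and all elements of [S] are equally likely to be it.
    For nonempty [S] the probability that it lies in [T] is thus [#|T| / #|S|]. *)
Lemma card_argmin_in (T : {set 'I_n}) : T \subset S ->
  #|S| * #|[set sg | [exists x in T, argmin_of sg x]]| = #|T| * #|{: 'S_n}|.
Proof.
case: (set_0Vmem S) => [->|[x0 x0S] TS].
  by rewrite subset0 => /eqP ->; rewrite cards0.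
have key (U : {set 'I_n}) : U \subset S ->
   #|[set sg | [exists x in U, argmin_of sg x]]| = #|U| * #|[set sg | argmin_of sg x0]|.
  move=> /subsetP US; rewrite -sum_nat_const.
  rewrite (eq_bigr (fun x => \sum_(sg : 'S_n) argmin_of sg x)); last first.
    move=> x /US xS; rewrite (card_argmin_of x0S xS) -sum1_card big_mkcond.
    by apply: eq_bigr => sg _; rewrite inE; case: argmin_of.
  rewrite exchange_big /= -sum1_card big_mkcond; apply: eq_bigr => sg _.
  rewrite inE; case: existsP => [[x /andP[xU ax]]|H].
    rewrite (bigD1 x) //= ax big1 // => y /andP[yU]; case ay: argmin_of => //.
    by rewrite (argmin_of_uniq ax ay) eqxx.
  rewrite big1 // => y yU; case ay: argmin_of => //.
  by case: H; exists y; rewrite yU.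
rewrite key // mulnCA; congr (_ * _); rewrite -key //; apply/esym/eq_card => sg.
rewrite !inE; apply/esym/existsP.
case: (arg_minnP (fun x => val (sg x)) x0S) => x xS H; exists x.
have {}xS : x \in S by [].
by rewrite /argmin_of xS; apply/forall_inP.
Qed.

End ArgMin.

(** * The hypergraph *)

Lemma card_ord_pred M (P : pred nat) : #|[set q : 'I_M | P q]| = \sum_(0 <= q < M) P q.
Proof.
rewrite -sum1_card big_mkcond big_mkord; apply: eq_bigr => q _.
by rewrite inE; case: (P q).
Qed.

Lemma card_ord_interval M a b : b <= M -> #|[set q : 'I_M | a <= q < b]| = b - a.
Proof.
move=> bM; rewrite (card_ord_pred M (fun q => a <= q < b)) -[RHS](_ : minn b M - a = _); last lia.
elim: {bM} M => [|M IH]; first by rewrite big_geq //; lia.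
rewrite big_nat_recr //= IH; lia.
Qed.

Section Skeleton.
Variables (k w : nat).
Hypothesis k3 : 2 < k.

(** Entries are omitted only at indices below [k * k] or from [late_start] on. The last summand [k]
    is slack: an entry at a good position in some vertex has an index larger by at most [k - 1], and
    so still lies in the middle zone. *)
Definition late_start := k * k + k * w + k.
Definition width := late_start + k * k.

(** Each [s] owns a row of length [k] in both outer zones, which makes the omitted sets disjoint.
    The late part completes every omitted set to [k - 1] elements, so that all vertices have equal
    size. *)
Definition omitted (s : 'I_k) : {set 'I_width} :=
  [set q : 'I_width | (s * k <= q < s * k + s) ||
    (late_start + s * k <= q < late_start + s * k + (k - 1 - s))].

Lemma omitted_row_bound (s : 'I_k) : s * k + k <= k * k.
Proof. by have := ltn_ord s; nia. Qed.

Lemma omitted_disjoint (s t : 'I_k) q : q \in omitted s -> q \in omitted t -> s = t.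
Proof.
have row (s1 t1 : 'I_k) x : s1 * k <= x < s1 * k + k -> t1 * k <= x < t1 * k + k -> s1 = t1.
  by move=> h1 h2; apply: val_inj => /=; clear -h1 h2; nia.
have hs := omitted_row_bound s; have ht := omitted_row_bound t.
have ls := ltn_ord s; have lt := ltn_ord t.
rewrite !inE => /orP[h1|h1] /orP[h2|h2].
- by apply: (row _ _ q); lia.
- by exfalso; rewrite /late_start in h2; lia.
- by exfalso; rewrite /late_start in h1; lia.
- by apply: (row _ _ (q - late_start)); lia.
Qed.

Lemma omitted_middle (s : 'I_k) (q : 'I_width) : k * k <= q < late_start -> q \notin omitted s.
Proof.
move=> h; have hs := omitted_row_bound s; have ls := ltn_ord s.
by rewrite inE; lia.
Qed.

Lemma card_omitted_below (s : 'I_k) (b : nat) :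
  late_start <= b <= width \/ k * k <= b < late_start ->
  #|[set q in omitted s | q < b]| =
  s + #|[set q : 'I_width | late_start + s * k <= q < minn b (late_start + s * k + (k - 1 - s))]|.
Proof.
move=> hb; have hs := omitted_row_bound s; have ls := ltn_ord s.
rewrite -[X in X + _](_ : #|[set q : 'I_width | s * k <= q < s * k + s]| = s); last first.
  by rewrite card_ord_interval ?addKn // /width /late_start; lia.
rewrite -cardsUI [X in _ + X](_ : _ = 0) ?addn0; last first.
  by apply/eqP; rewrite cards_eq0; apply/eqP/setP => q; rewrite !inE /late_start; lia.
by apply: eq_card => q; rewrite !inE /late_start; rewrite /late_start in hb; lia.
Qed.

Lemma card_omitted (s : 'I_k) : #|omitted s| = k.-1.
Proof.
have hs := omitted_row_bound s; have ls := ltn_ord s.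
have <- : #|[set q in omitted s | q < width]| = #|omitted s|.
  by apply: eq_card => q; rewrite [LHS]inE (ltn_ord q) andbT.
rewrite card_omitted_below; last by left; rewrite /width; lia.
by rewrite ?card_ord_interval /width; lia.
Qed.

Lemma card_omitted_middle (s : 'I_k) (p : 'I_width) :
  k * k <= p < late_start -> #|[set q in omitted s | q < p]| = s.
Proof.
move=> hp; rewrite card_omitted_below; last by right.
rewrite card_ord_interval; first by lia.
by rewrite geq_min (ltnW (ltn_ord p)).
Qed.

Lemma card_kept_lt (s : 'I_k) (p : 'I_width) :
  #|[set q in ~: omitted s | q < p]| + #|[set q in omitted s | q < p]| = p.
Proof.
rewrite -[RHS]card_ord_lt -cardsUI [X in _ + X](_ : _ = 0) ?addn0; last first.
  by apply/eqP; rewrite cards_eq0; apply/eqP/setP => q; rewrite !inE; lia.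
by apply: eq_card => q; rewrite !inE; lia.
Qed.

Definition good_position p := (k * k <= p < k * k + k * w) && ~~ (k %| p).

(** The pair [(i, j)] is sent to [k * k + i * k + j + 1], where [j + 1] runs over the nonzero
    residues modulo [k]. *)
Lemma card_good_position m : k * k + k * w <= m ->
  w * k.-1 <= #|[set p : 'I_m | good_position p]|.
Proof.
move=> le.
have ltf (x : 'I_w * 'I_k.-1) : k * k + x.1 * k + x.2.+1 < m.
  by have := ltn_ord x.1; have := ltn_ord x.2; nia.
pose f x : 'I_m := Ordinal (ltf x).
have lt2 (x : 'I_k.-1) : x.+1 < k by have := ltn_ord x; lia.
have fI : injective f.
  move=> x y /(congr1 val) /= e.
  have {}e : x.1 * k + x.2.+1 = y.1 * k + y.2.+1 by lia.
  have k0 : 0 < k by lia.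
  have := congr1 (divn^~ k) e; have := congr1 (modn^~ k) e.
  rewrite !modnMDl !divnMDl // !modn_small // !divn_small // !addn0 => -[e2] e1.
  by case: x y e1 e2 {e} => [x1 x2] [y1 y2] /= /val_inj -> /val_inj ->.
rewrite -[w]card_ord -[k.-1 in X in X <= _]card_ord -card_prod -cardsT -(card_imset _ fI).
apply: subset_leq_card; apply/subsetP => _ /imsetP[x _ ->].
rewrite inE /good_position /= -mulnDl.
apply/andP; split; last by rewrite dvdn_addr ?dvdn_mull // gtnNdvd.
have h1 : x.1.+1 * k <= w * k by rewrite leq_mul2r (ltn_ord x.1) orbT.
have h2 := lt2 x.2; rewrite mulSn in h1; rewrite mulnDl (mulnC k w).
move: h1 h2; move: (x.1 * k) (w * k) (k * k) (nat_of_ord x.2) => a b c e; clear. lia.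
Qed.

Section Vertices.
Variable n : nat.
Implicit Type u : {ffun 'I_width -> 'I_n}.

Definition vertex u s : {set 'I_n} := u @: (~: omitted s).

Definition selected (sg : 'S_n) (S : {set 'I_n}) :=
  [exists x in [set x in S | good_position (position S x)], argmin_of S sg x].

Lemma vertex_inj u : increasing u -> injective (vertex u).
Proof.
move=> iu s t /(imset_inj (increasing_inj iu)) /setC_inj e.
have : 0 < #|omitted s| by rewrite card_omitted; lia.
by case/card_gt0P => q qs; apply: (omitted_disjoint qs); rewrite -e.
Qed.

(** Since omitted sets are disjoint, two vertices of an edge already cover the range of [u], and the
    range determines [u]. *)
Lemma vertex_linear u u' s t s' t' : increasing u -> increasing u' -> s != t ->
  vertex u s = vertex u' s' -> vertex u t = vertex u' t' -> u = u'.
Proof.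
move=> iu iu' st es et; apply: increasing_range_inj => //.
apply/eqP; rewrite eqEcard !card_imset ?leqnn ?andbT; try exact: increasing_inj.
have : vertex u s :|: vertex u t = u @: setT.
  rewrite /vertex -imsetU -setCI (_ : _ :&: _ = set0) ?setC0 //.
  apply/setP => q; rewrite in_setI in_set0; apply/negP => /andP[qs qt].
  by rewrite (omitted_disjoint qs qt) eqxx in st.
move=> <-; rewrite es et subUset; apply/andP.
by split; apply/imsetS/subsetP => q; rewrite inE.
Qed.

Lemma card_vertex u s : increasing u -> #|vertex u s| = 2 * (k * k) + k * w + 1.
Proof.
move=> iu; rewrite (card_imset _ (increasing_inj iu)) cardsCs setCK card_ord card_omitted.
by rewrite /width /late_start; lia.
Qed.

(** Let [p] be the index of the minimum over all of [u]. If every vertex were selected, [p] would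
    lie in the middle zone; but the vertex with index [t = p mod k] has [u p] at position [p - t],
    which is divisible by [k]. *)
Lemma selected_independent u sg : increasing u -> exists s, ~~ selected sg (vertex u s).
Proof.
move=> iu; apply/existsP; rewrite -[X in is_true X]negbK negb_exists; apply/negP => /forallP H.
have {}H s : selected sg (vertex u s) by rewrite -[selected _ _]negbK H.
have k0 : 0 < k by lia.
have M0 : 0 < width by rewrite /width /late_start; nia.
case: (arg_minnP (fun p => val (sg (u p))) (erefl : xpredT (Ordinal M0))) => p _ pmin.
have am s : p \notin omitted s -> argmin_of (vertex u s) sg (u p).
  move=> ps; apply/andP; split; first by apply: imset_f; rewrite inE.
  by apply/forall_inP => _ /imsetP[q _ ->]; apply: pmin.
have good s : p \notin omitted s -> good_position (position (vertex u s) (u p)).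
  move=> ps; have /existsP[x /andP[+ ax]] := H s.
  by rewrite inE => /andP[_]; rewrite (argmin_of_uniq (am s ps) ax).
(* At most one vertex omits [p], so one of the indices 0 and 1 keeps it. *)
have [s ps] : exists s, p \notin omitted s.
  have [p0|p0] := boolP (p \in omitted (Ordinal k0)); last by exists (Ordinal k0).
  have k1 : 1 < k by lia.
  exists (Ordinal k1); apply/negP => /(omitted_disjoint p0); by case.
have pm : k * k <= p < late_start.
  have := good s ps; rewrite position_imset // => /andP[h _].
  have := card_kept_lt s p.
  have : #|[set q in omitted s | q < p]| <= k.-1.
    by rewrite -(card_omitted s); apply/subset_leq_card/subsetP => q; rewrite inE => /andP[].
  by rewrite /late_start; lia.
pose t := Ordinal (ltn_pmod p k0).
have pt : p \notin omitted t by apply: omitted_middle.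
have := good t pt; rewrite position_imset // => /andP[_ /negP]; apply.
have := card_kept_lt t p; rewrite (card_omitted_middle t pm).
move: #|_| => c e; have -> : c = p %/ k * k.
  by apply/eqP; rewrite -(eqn_add2r t) e {1}(divn_eq p k).
exact: dvdn_mull.
Qed.

(** The minimum is equidistributed over the positions. The resulting bound
    [w (k-1) / (2k^2 + kw + 1)] tends to [(k-1)/k] as [w] grows, which is what the parameter [w] is
    for. *)
Lemma selected_density u s : increasing u ->
  (w * k.-1) * #|{: 'S_n}| <=
  (2 * (k * k) + k * w + 1) * #|[set sg : 'S_n | selected sg (vertex u s)]|.
Proof.
move=> iu; rewrite -(card_vertex s iu) card_argmin_in; last first.
  by apply/subsetP => x; rewrite inE => /andP[].
rewrite leq_mul2r; apply/orP; right.
apply: leq_trans (card_position _ _); apply: card_good_position.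
by rewrite card_vertex //; lia.
Qed.

End Vertices.

(** All vertices have the same size, so Ramsey's theorem for sets of that size gives a homogeneous
    set of [width] elements; [u] lists it in increasing order. *)
Lemma vertex_ramsey r : exists n, forall c : {set 'I_n} -> 'I_r,
  exists2 u : {ffun 'I_width -> 'I_n}, increasing u &
    forall s t, c (vertex u s) = c (vertex u t).
Proof.
have [n Hn] := finite_ramsey 'I_r (2 * (k * k) + k * w + 1) width.
exists n => c.
have [|t [st sz Ht]] := Hn _ (enum 'I_n) (fun a => c [set x in a]) (enum_uniq _).
  by rewrite size_enum_ord.
have n0 : 0 < n.
  have := size_subseq st; rewrite sz size_enum_ord /width /late_start; nia.
pose u : {ffun 'I_width -> 'I_n} := [ffun p : 'I_width => nth (Ordinal n0) t p].
have sorted_t : sorted (fun x y : 'I_n => x < y) t.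
  apply: (subseq_sorted _ st); first by move=> x y z; apply: ltn_trans.
  by have := iota_ltn_sorted 0 n; rewrite -val_enum_ord sorted_map.
have iu : increasing u.
  apply/increasingP => p q pq; rewrite !ffunE.
  apply: (sorted_ltn_nth (leT := fun x y : 'I_n => x < y)) => //;
    by [move=> x y z; apply: ltn_trans|rewrite inE sz].
exists u => //.
have E s : exists a, [/\ subseq a t, size a = 2 * (k * k) + k * w + 1 & vertex u s = [set x in a]].
  exists [seq x <- t | x \in vertex u s]; split.
  - exact: filter_subseq.
  - rewrite -(card_vertex s iu) -[LHS](card_uniqP _); last first.
      by rewrite filter_uniq // (subseq_uniq st) // enum_uniq.
    apply: eq_card => x; rewrite mem_filter; case: (boolP (x \in vertex u s)) => //=.
    by case/imsetP => q _ ->; rewrite ffunE mem_nth // sz.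
  - apply/setP => x; rewrite !inE mem_filter; case: (boolP (x \in vertex u s)) => //=.
    by case/imsetP => q _ ->; rewrite ffunE mem_nth // sz.
move=> s s'; have [a [a1 a2 ->]] := E s; have [b [b1 b2 ->]] := E s'.
exact: Ht.
Qed.

End Skeleton.

(** The distribution on independent sets is the uniform one on [Om], realised by the orders of the
    ground set. *)
Lemma sparse_hypergraph (R : realType) (k r : nat) (mu : R) : 2 < k ->
  (mu < (k%:R - 1) / k%:R)%R ->
  exists (V E Om : finType) (v : E -> 'I_k -> V) (sel : Om -> V -> bool),
  [/\ forall e, injective (v e),
      forall e e' s t s' t', s != t -> v e s = v e' s' -> v e t = v e' t' -> e = e',
      forall c : V -> 'I_r, exists e, forall s t, c (v e s) = c (v e t),
      forall om e, exists s, ~~ sel om (v e s) &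
      0 < #|Om| /\
      forall e s, (mu * #|Om|%:R <= #|[set om | sel om (v e s)]|%:R)%R].
Proof.
move=> k3 hmu.
have k0 : (0 < k%:R :> R)%R by rewrite ltr0n; lia.
(* The required inequality [mu (2k^2 + kw + 1) <= w (k-1)] is equivalent to [num <= w dl], and [dl]
   is positive by the bound on [mu]. *)
pose dl := (k%:R - 1 - mu * k%:R)%R.
have dl0 : (0 < dl)%R by rewrite subr_gt0 -ltr_pdivlMr.
pose num := (mu * (2 * (k * k) + 1)%N%:R)%R.
pose w := Num.bound `|num / dl|%R.
have hw : (num <= w%:R * dl)%R.
  rewrite -ler_pdivrMr //; apply: le_trans (ler_norm _) _; apply: ltW.
  by apply: archi_boundP; rewrite normr_ge0.
have [n Hn] := vertex_ramsey w k3 r.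
pose E := {u : {ffun 'I_(width k w) -> 'I_n} | increasing u}.
exists {set 'I_n}, E, 'S_n, (fun e : E => vertex (val e)), (selected k w (n := n)); split.
- by move=> e; apply: vertex_inj => //; apply: valP.
- move=> e e' s t s' t' st es et; apply: val_inj.
  exact: (vertex_linear k3 (valP e) (valP e') st es et).
- by move=> c; have [u iu hu] := Hn c; exists (Sub u iu).
- by move=> om e; apply: selected_independent => //; apply: valP.
- split; first by apply/card_gt0P; exists 1%g.
  move=> e s; have := selected_density k3 s (valP e).
  rewrite -(ler_nat R) !natrM; set a := (_ + _ + _); set c := #|_|; set d := #|_|.
  move=> h.
  have a0 : (0 < a%:R :> R)%R by rewrite ltr0n /a; lia.
  rewrite -(ler_pM2l a0); apply: le_trans h.
  rewrite mulrA ler_wpM2r // /a -subn1 natrB; last lia.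
  have -> : (2 * (k * k) + k * w + 1) = (2 * (k * k) + 1) + k * w by lia.
  rewrite natrD (natrM _ k w) mulrC mulrDr -/num.
  apply: le_trans (lerD hw (lexx _)) _.
  suff -> : (w%:R * dl + mu * (k%:R * w%:R) = w%:R * (k%:R - 1))%R by [].
  by rewrite /dl; ring.
Qed.

(** * The partite construction *)

Section PartiteConstruction.
Variables (k : nat) (V : eqType) (E : Type) (v : E -> 'I_k -> V).
Hypothesis k3 : 2 < k.
Hypothesis v_inj : forall e, injective (v e).
Hypothesis v_lin : forall e e' s t s' t',
  s != t -> v e s = v e' s' -> v e t = v e' t' -> e = e'.

(** The permutation [t] is present because a quasiline may run through an edge in any order. *)
Definition is_edge (g : 'I_k -> V) :=
  exists e (t : 'I_k -> 'I_k), injective t /\ forall s, g s = v e (t s).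

Lemma is_edge_inj g : is_edge g -> injective g.
Proof. by move=> [e [t [tI gE]]] s s'; rewrite !gE => /v_inj /tI. Qed.

Lemma is_edge_ext g g' : g =1 g' -> is_edge g -> is_edge g'.
Proof. by move=> gg' [e [t [tI gE]]]; exists e, t; split=> // s; rewrite -gg'. Qed.

Lemma third_index (s t : 'I_k) : exists2 x, x != s & x != t.
Proof.
have [x] : exists x, x \in ~: [set s; t].
  apply/card_gt0P; rewrite cardsCs setCK card_ord subn_gt0.
  by apply: leq_ltn_trans k3; rewrite cards2; case: (s != t).
by rewrite !inE negb_or => /andP[]; exists x.
Qed.

(** Here [A s] is the active set of the line carrying the [s]-th point, [eta s] is the projection of
    that point, and fixed entries project to [j]. If [eta] is not an edge, an edge block [b0] misses
    one index [f0] and another edge block [b1] misses some [f1]; linearity then forces the excluded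
    union of active sets. *)
Lemma is_edge_of_blocks (J : Type) (A : 'I_k -> J -> bool) (eta : 'I_k -> V) (j : V) :
  let g b s := if A s b then eta s else j in
  (forall s, exists b, A s b) ->
  (forall s0 s1 s2, ~ disjoint_union (A s0) (A s1) (A s2)) ->
  (forall b, (forall s t, g b s = g b t) \/ is_edge (g b)) ->
  (exists b, is_edge (g b)) -> is_edge eta.
Proof.
move=> g Anon schur blk [b0 Eb0].
have gA b s : A s b -> g b s = eta s by rewrite /g => ->.
have gN b s : ~~ A s b -> g b s = j by rewrite /g => /negbTE ->.
have full b : is_edge (g b) -> (forall s, A s b) -> is_edge eta.
  by move=> Eb Ab; apply: is_edge_ext Eb => s; apply: gA.
have uniqN b s t : is_edge (g b) -> ~~ A s b -> t != s -> A t b.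
  move=> Eb nA; apply: contraR => nA'; apply/eqP/(is_edge_inj Eb).
  by rewrite !gN.
have [/forallP h|] := boolP [forall s, A s b0]; first exact: full h.
rewrite negb_forall => /existsP[f0 nA0].
have gI := is_edge_inj Eb0.
have A0 s : s != f0 -> A s b0 by apply: uniqN.
have eta0 s : s != f0 -> g b0 s = eta s by move=> /A0; apply: gA.
have etaj s : s != f0 -> eta s != j.
  move=> sf; rewrite -eta0 // -(gN _ _ nA0); by apply: contra_neq sf; apply: gI.
have [ej|nej] := eqVneq (eta f0) j.
  by apply: is_edge_ext Eb0 => s; have [->|/eta0//] := eqVneq s f0; rewrite gN.
have [b1 Ab1] := Anon f0.
have etaI s t : s != f0 -> t != f0 -> eta s = eta t -> s = t.
  by move=> sf tf; rewrite -!eta0 //; apply: gI.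
have [cst|Eb1] := blk b1.
  have c s : eta s = eta f0.
    have := cst s f0; rewrite (gA _ _ Ab1) /g; case: ifP => // _ e.
    by rewrite e eqxx in nej.
  have [f1 f10 _] := third_index f0 f0; have [f2 f20 f21] := third_index f0 f1.
  by rewrite (etaI f2 f1 f20 f10) ?eqxx ?c // in f21.
have [/forallP h|] := boolP [forall s, A s b1]; first exact: full h.
rewrite negb_forall => /existsP[f1 nA1].
have f10 : f1 != f0 by apply: contraNneq nA1 => ->.
have [f2 f20 f21] := third_index f0 f1.
have A1 s : s != f1 -> A s b1 by apply: uniqN.
(* Both blocks contain the vertices [j] and [eta f2], so they run through the same edge. Its vertex
   [eta f1] can occur in block [b1] only at the index [f0]. *)
have eq1 : eta f1 = eta f0.
  have [e [t [tI gE]]] := Eb0; have [e' [t' [tI' gE']]] := Eb1.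
  have ee : e = e'.
    apply: (@v_lin e e' (t f0) (t f2) (t' f1) (t' f2)).
    - by rewrite (inj_eq tI) eq_sym.
    - by rewrite -gE -gE' !gN.
    - by rewrite -gE -gE' !gA // ?A1 ?A0.
  have /codomP[s sE] : t f1 \in codom t' by apply: injF_onto.
  have gs : g b1 s = eta f1 by rewrite gE' -sE -ee -gE eta0.
  have [sf1|sf1] := eqVneq s f1.
    by move: gs (etaj _ f10); rewrite sf1 gN // => ->; rewrite eqxx.
  have [sf0|sf0] := eqVneq s f0; first by rewrite -gs sf0 gA.
  rewrite gA ?A1 // in gs.
  by rewrite (etaI s f1 sf0 f10 gs) eqxx in sf1.
have n2 : eta f2 != eta f0.
  by rewrite -eq1; apply: contra_neq f21; apply: etaI.
have nj2 := etaj _ f20.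
have g01 b s : g b s = eta s \/ g b s = j by rewrite /g; case: ifP; [left|right].
(* Now [eta f0 = eta f1], and this vertex, [eta f2] and [j] are distinct. In a constant block all
   three indices are inactive; in an edge block [f2] and exactly one of [f0], [f1] are active. *)
exfalso; apply: (schur f0 f1 f2) => b.
have D : ~~ (A f0 b && A f1 b).
  apply/negP => /andP[a0 a1]; case: (blk b) => [cst|/is_edge_inj I].
    have := cst f2 f0; rewrite (gA _ _ a0); case: (g01 b f2) => -> e.
      by rewrite e eqxx in n2.
    by rewrite e eqxx in nej.
  by move: f10; rewrite (I f1 f0) ?eqxx // !gA.
split=> //; apply/idP/idP => [a2|].
  case: (blk b) => [cst|/is_edge_inj I].
    have := cst f2 f0; rewrite (gA _ _ a2); case: (g01 b f0) => -> e.
      by rewrite e eqxx in n2.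
    by rewrite e eqxx in nj2.
  apply: contraT; rewrite negb_or => /andP[a0 a1].
  by move: f10; rewrite (I f1 f0) ?eqxx // !gN.
have main s t : A s b -> ~~ A t b -> eta s = eta f0 -> f2 != t -> A f2 b.
  move=> a0 a1 es ft; apply: contraT => a2; case: (blk b) => [cst|/is_edge_inj I].
    by have := cst s t; rewrite gA // gN // es => e; rewrite e eqxx in nej.
  by move: ft; rewrite (I f2 t) ?eqxx // !gN.
case/orP => a.
  by apply: (main f0 f1) => //; move: D; rewrite a.
by apply: (main f1 f0) => //; move: D; rewrite a andbT.
Qed.

Definition const_or_inj (T : Type) (f : 'I_k -> T) :=
  (forall s t, f s = f t) \/ injective f.

(* The points [X], embedded by [vec] in the cube over ['I_k], are projected to the
   hypergraph by [h]; [js] lists the vertices of the hypergraph along which the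
   amalgamation has already been carried out. *)
Definition picture (C I X : finType) (vec : X -> {ffun I -> 'I_k}) (h : X -> V) (js : seq V) :=
  [/\ forall x y, vec x = vec y -> h x = h y,
      forall x : 'I_k -> X, (forall i, const_or_inj (fun s => vec (x s) i)) ->
        (exists i s t, vec (x s) i <> vec (x t) i) -> is_edge (h \o x) &
      forall c : {ffun I -> 'I_k} -> C, exists gam : V -> C, forall e,
        exists (l : 'I_k -> X) (a : I -> option 'I_k),
        [/\ exists i, active a i,
            forall s, vec (l s) = fill a (fun=> s),
            forall s, h (l s) = v e s &
            forall s, v e s \in js -> c (vec (l s)) = gam (v e s)]].

(** A new word is a [J]-tuple of old words. The point [(L, x)] has [x] at the active coordinates of
    the line [L], whose fixed letters are points above [j]. Each block of a quasiline is then
    constant in projection or projects to an edge, as [is_edge_of_blocks] requires. For a colouring,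
    Hales-Jewett supplies a line on which all points above [j] agree, and the old picture is applied
    to its copy along this line. *)
Lemma picture_step (C I X : finType) (vec : X -> {ffun I -> 'I_k}) (h : X -> V) js j :
  picture C vec h js ->
  exists (I' X' : finType) (vec' : X' -> {ffun I' -> 'I_k}) (h' : X' -> V),
    picture C vec' h' (j :: js).
Proof.
move=> [wd ql ram].
have [J [Lines [l1 l2 l3 l4]]] := hales_jewett_union_free C [seq x <- enum X | h x == j].
pose M := {L : {ffun J -> option X} | `[< Lines L >]}.
have LM (m : M) : Lines (val m) by apply/asboolP/(valP m).
have hL (m : M) b y : val m b = Some y -> h y = j.
  by move=> /(l1 _ (LM m)); rewrite mem_filter => /andP[/eqP].
pose ent (x : M * X) b := odflt x.2 (val x.1 b).
pose vec' (x : M * X) : {ffun (J * I) -> 'I_k} := [ffun bi => vec (ent x bi.1) bi.2].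
pose h' (x : M * X) := h x.2.
have hent x b : h (ent x b) = if active (val x.1) b then h' x else j.
  rewrite /ent /active /h'; case e: (val x.1 b) => [y|] //=; exact: (hL x.1 b).
have vE x b i : vec' x (b, i) = vec (ent x b) i by rewrite ffunE.
exists (J * I)%type, (M * X)%type, vec', h'; split.
- move=> x y e.
  have eb b : h (ent x b) = h (ent y b).
    by apply: wd; apply/ffunP => i; rewrite -!vE e.
  have [b0 a0] := l2 _ (LM x.1); have [b1 a1] := l2 _ (LM y.1).
  have := eb b0; have := eb b1; rewrite !hent a0 a1.
  case: ifP => [//|_ e1]; case: ifP => [_ //|_ e0]; by rewrite e0 -e1.
- move=> x ci [[b0 i0] [s0 [t0 ne0]]].
  apply: (@is_edge_of_blocks J (fun s => active (val (x s).1)) _ j).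
  + by move=> s; apply: l2; apply: LM.
  + by move=> s0' s1 s2; apply: l3; apply: LM.
  + move=> b; case: (pselect (exists i s t, vec (ent (x s) b) i <> vec (ent (x t) b) i)) => H.
      right; apply: is_edge_ext (ql (fun s => ent (x s) b) _ H) => [s|i].
        by rewrite /= hent.
      by have := ci (b, i); congr const_or_inj; apply/funext => s; rewrite vE.
    left=> s t; rewrite -!hent; apply: wd; apply/ffunP => i.
    by apply: contrapT => ne; apply: H; exists i, s, t.
  + exists b0; apply: is_edge_ext (ql (fun s => ent (x s) b0) _ _) => [s|i|].
    * by rewrite /= hent.
    * by have := ci (b0, i); congr const_or_inj; apply/funext => s; rewrite vE.
    * by exists i0, s0, t0; rewrite -!vE.
- move=> c.
  have [L0 lL HL] := l4 (fun w => c [ffun bi => vec (w bi.1) bi.2]).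
  pose L : {ffun J -> option X} := [ffun b => L0 b].
  have eL : L = L0 :> (J -> option X) by apply/funext => b; rewrite ffunE.
  have LL : `[< Lines L >] by apply/asboolP; rewrite eL.
  pose m : M := Sub L LL.
  pose lift (w : {ffun I -> 'I_k}) : {ffun (J * I) -> 'I_k} :=
    [ffun bi => if L bi.1 is Some y then vec y bi.2 else w bi.2].
  have vlift x : vec' (m, x) = lift (vec x).
    by apply/ffunP => -[b i]; rewrite !ffunE /ent /= ffunE; case: (L0 b).
  have [gam Hgam] := ram (c \o lift).
  have mono x y : h x = j -> h y = j -> c (lift (vec x)) = c (lift (vec y)).
    have inj x' : h x' = j -> x' \in [seq x <- enum X | h x == j].
      by move=> hx; rewrite mem_filter hx eqxx mem_enum.
    move=> hx hy; have := HL x y (inj x hx) (inj y hy).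
    by congr (c _ = c _); apply/ffunP => -[b i]; rewrite !ffunE /=; case: (L0 b).
  (* Any point above [j] may define the colour at [j], since [mono] gives all of them the same
     colour along [L]. *)
  exists (fun a => if a == j then
            if [pick x | h x == j] is Some x then c (lift (vec x)) else gam a
          else gam a) => e.
  have [l [a [[i ai] la lh lc]]] := Hgam e.
  exists (fun s => (m, l s)), (fun bi => if L bi.1 is Some y then Some (vec y bi.2) else a bi.2).
  split.
  + have [b ab] := l2 _ lL; exists (b, i); move: ab ai; rewrite /active /= ffunE.
    by case: (L0 b).
  + move=> s; rewrite vlift la; apply/ffunP => -[b i']; rewrite !ffunE /=.
    by case: (L0 b).
  + by move=> s; rewrite /h' /= lh.
  + move=> s; rewrite vlift inE; case: eqVneq => [ej _|nej /= ejs]; last exact: lc.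
    case: pickP => [x /eqP hx|/(_ (l s))]; last by rewrite lh ej eqxx.
    by apply: mono; rewrite ?lh.
Qed.

End PartiteConstruction.

(** One line per edge. The coordinate [(e, true)] is a flag for the edge [e]; it takes only two of
    the [k] letters, so it cannot be injective on a quasiline, which therefore stays within one
    edge. *)
Lemma picture_start (k : nat) (V : eqType) (C E : finType) (v : E -> 'I_k -> V) : 2 < k ->
  exists (I X : finType) (vec : X -> {ffun I -> 'I_k}) (h : X -> V), picture v C vec h [::].
Proof.
move=> k3.
have k0 : 0 < k by lia.
have k1 : 1 < k by lia.
pose o0 := Ordinal k0; pose o1 := Ordinal k1.
pose vec (x : E * 'I_k) : {ffun (E * bool) -> 'I_k} :=
  [ffun eb => if eb.1 == x.1 then if eb.2 then o1 else x.2 else o0].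
have vT e x : vec x (e, true) = if e == x.1 then o1 else o0 by rewrite ffunE.
have vF e x : vec x (e, false) = if e == x.1 then x.2 else o0 by rewrite ffunE.
exists (E * bool)%type, (E * 'I_k)%type, vec, (fun x => v x.1 x.2); split.
- move=> [e s] [e' s'] eq.
  have := vT e (e, s); rewrite eq vT /= eqxx; case: eqP => // ee _; subst e'.
  by have := vF e (e, s); rewrite eq vF /= eqxx => ->.
- move=> x ci [i [s0 [t0 ne]]].
  have ee s : (x s).1 = (x s0).1.
    have [cst|I] := ci ((x s0).1, true).
      by have := cst s s0; rewrite !vT eqxx; case: eqP.
    have : #|'I_k| <= #|[set o0; o1]|.
      rewrite -cardsT -(card_imset _ I); apply: subset_leq_card.
      apply/subsetP => _ /imsetP[t _ ->]; rewrite vT !inE.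
      by case: ifP; rewrite eqxx ?orbT.
    by rewrite card_ord cards2 /=; lia.
  exists (x s0).1, (fun s => (x s).2); split; last by move=> s /=; rewrite ee.
  have [cst|I] := ci ((x s0).1, false).
    case: ne; have {}cst : (x s0).2 = (x t0).2.
      by have := cst s0 t0; rewrite !vF (ee t0) !eqxx.
    by rewrite (surjective_pairing (x t0)) (ee t0) -cst -surjective_pairing.
  by move=> s t e; apply: I; rewrite !vF (ee s) (ee t) eqxx.
- move=> c; exists (fun=> c [ffun=> o0]) => e.
  exists (fun s => (e, s)),
    (fun eb => if eb.1 == e then if eb.2 then Some o1 else None else Some o0).
  split=> //; first by exists (e, false); rewrite /active /= eqxx.
  by move=> s; apply/ffunP => -[e' b]; rewrite !ffunE /=; case: eqP; case: b.
Qed.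

Lemma picture_exists (k : nat) (V C E : finType) (v : E -> 'I_k -> V) : 2 < k ->
  (forall e, injective (v e)) ->
  (forall e e' s t s' t', s != t -> v e s = v e' s' -> v e t = v e' t' -> e = e') ->
  forall js : seq V, exists (I X : finType) (vec : X -> {ffun I -> 'I_k}) (h : X -> V),
    picture v C vec h js.
Proof.
move=> k3 vI vl; elim=> [|j js [I [X [vec [h P]]]]]; first exact: picture_start.
exact: (picture_step k3 vI vl j P).
Qed.

Lemma sparse_word_system (R : realType) (k r : nat) (mu : R) : 2 < k ->
  (mu < (k%:R - 1) / k%:R)%R ->
  exists (I X Om : finType) (vec : X -> {ffun I -> 'I_k}) (sel : Om -> X -> bool),
  [/\ forall c : {ffun I -> 'I_k} -> 'I_r, exists (l : 'I_k -> X) (a : I -> option 'I_k),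
        [/\ exists i, active a i, forall s, vec (l s) = fill a (fun=> s) &
            forall s t, c (vec (l s)) = c (vec (l t))],
      forall om (x : 'I_k -> X), (forall i, const_or_inj (fun s => vec (x s) i)) ->
        (exists i s t, vec (x s) i <> vec (x t) i) -> exists s, ~~ sel om (x s) &
      0 < #|Om| /\ forall x, (mu * #|Om|%:R <= #|[set om | sel om x]|%:R)%R].
Proof.
move=> k3 hmu.
have [V [E [Om [v [sel [vI vl vram vind [Om0 vdens]]]]]]] := sparse_hypergraph r k3 hmu.
have [I [X [vec [h [wd ql ram]]]]] := picture_exists 'I_r k3 vI vl (enum V).
pose rng x := [exists e, [exists s, h x == v e s]].
(* Points projecting to no edge are always selected. This keeps their density at 1, and they lie on
   no nonconstant quasiline. *)
exists I, X, Om, vec, (fun om x => rng x ==> sel om (h x)); split.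
- move=> c; have [gam Hg] := ram c; have [e He] := vram gam.
  have [l [a [ai la lh lc]]] := Hg e; exists l, a; split=> // s t.
  by rewrite !lc ?mem_enum // (He s t).
- move=> om x ci ne; have [e [t [tI ht]]] := ql x ci ne.
  have [s hs] := vind om e.
  have /codomP[s' e'] : s \in codom t by apply: injF_onto.
  exists s'; rewrite negb_imply; rewrite /= in ht; rewrite ht -e' hs andbT.
  by apply/existsP; exists e; apply/existsP; exists s; rewrite ht e'.
- split=> // x; case: (boolP (rng x)) => [/existsP[e /existsP[s /eqP ->]]|nr] /=.
    exact: vdens.
  have -> : #|[set om : Om | true]| = #|Om| by rewrite -cardsT; apply: eq_card => om; rewrite !inE.
  rewrite ler_piMl // ltW //; apply: lt_trans hmu _.
  rewrite ltr_pdivrMr ?mul1r ?gtrBl ?ltr0n //; lia.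
Qed.

(** * From words to lattice points *)

Local Open Scope ring_scope.

Definition zsq d (x y : lpt d) : int := \sum_(i < d) (x 0 i - y 0 i) ^+ 2.

Lemma zsq_ge0 d (x y : lpt d) : 0 <= zsq x y.
Proof. by apply: sumr_ge0 => i _; apply: sqr_ge0. Qed.

Lemma zsq_eq0 d (x y : lpt d) : (zsq x y == 0) = (x == y).
Proof.
rewrite psumr_eq0 => [|i _]; last exact: sqr_ge0.
apply/allP/eqP => [H|-> i _]; last by rewrite subrr expr0n.
apply/rowP => i; have := H i; rewrite mem_index_enum sqrf_eq0 subr_eq0 => /(_ isT).
by move/eqP.
Qed.

Lemma zsq_ge1 d (x y : lpt d) : x != y -> 1 <= zsq x y.
Proof. by rewrite -zsq_eq0 => h; have := zsq_ge0 x y; move: h; lia. Qed.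

Lemma zsqDr d (x y a : lpt d) : zsq (x + a) (y + a) = zsq x y.
Proof. by apply: eq_bigr => i _; rewrite !mxE; congr (_ ^+ 2); ring. Qed.

Lemma zsq_scale_add d (q : int) (x y x' y' : lpt d) :
  zsq (q *: x + x') (q *: y + y') =
  zsq x y * q ^+ 2 + (2 * \sum_(i < d) (x 0 i - y 0 i) * (x' 0 i - y' 0 i)) * q + zsq x' y'.
Proof.
rewrite /zsq mulr_suml mulr_sumr mulr_suml -!big_split /=; apply: eq_bigr => i _.
by rewrite !mxE; ring.
Qed.

Lemma zsq_coord d (x y : lpt d) i : (x 0 i - y 0 i) ^+ 2 <= zsq x y.
Proof.
rewrite /zsq (bigD1 i) //= lerDl; apply: sumr_ge0 => j _; exact: sqr_ge0.
Qed.

Lemma zsq_ub d (x y : lpt d) (B : int) :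
  (forall i, - B <= x 0 i - y 0 i <= B) -> zsq x y <= d%:Z * B ^+ 2.
Proof.
move=> H; rewrite /zsq; apply: le_trans (_ : \sum_(i < d) B ^+ 2 <= _).
  by apply: ler_sum => i _; have := H i; nia.
by rewrite sumr_const card_ord -[d%:Z]natz mulr_natl.
Qed.

(** * Similar families and the weights that map words to lattice points *)

Section Similarity.
Variables (d k : nat) (f : 'I_k -> lpt d).
Hypothesis f_inj : injective f.

(* Homogeneous form of "similar to [f]": constant families are included, which makes
   the condition pass to single coordinates. *)
Definition similar (z : 'I_k -> lpt d) :=
  forall s t s' t', zsq (z s) (z t) * zsq (f s') (f t') = zsq (z s') (z t') * zsq (f s) (f t).

Lemma similar_const_or_inj z : similar z -> const_or_inj z.
Proof.
move=> sim; case: (pselect (injective z)) => zI; [by right|left].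
have [s [t [est nst]]] : exists s t, z s = z t /\ s <> t.
  apply: contrapT => H; apply: zI => s t e; apply: contrapT => ne.
  by apply: H; exists s, t.
move=> s' t'; apply/eqP; rewrite -zsq_eq0.
have /eqP := sim s t s' t'; rewrite est (_ : zsq (z t) (z t) = 0); last first.
  by apply/eqP; rewrite zsq_eq0.
rewrite mul0r eq_sym mulf_eq0 => /orP[//|].
by rewrite (zsq_eq0 (f s)) => /eqP e; case: nst; apply: f_inj.
Qed.

Lemma similar_add z a : similar (fun s => z s + a) <-> similar z.
Proof. by split=> H s t s' t'; have := H s t s' t'; rewrite !zsqDr. Qed.

(** Digits in base [q]: [c] is a multiple of [q] smaller than [q] in absolute value, hence 0, and
    the same argument then applies to [b]. *)
Lemma quadratic_zero (a b c : int) (q : nat) : (`|a| + `|b| + `|c| < q)%N ->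
  a * q%:Z ^+ 2 + b * q%:Z + c = 0 -> a = 0 /\ c = 0.
Proof.
move=> lt e.
have small (x y : int) : (`|x| < q)%N -> x + y * q%:Z = 0 -> x = 0 /\ y = 0.
  by move=> h e'; have : y = 0; [nia|move=> y0; rewrite y0 in e'; split; lia].
have [||-> h] := small c (a * q%:Z + b); [lia|lia|].
by have [||_ ->] := small b a; [lia|lia|].
Qed.

(** Weights are chosen one coordinate at a time. Each similarity equation is quadratic in the new
    weight: its leading coefficient is the defect of the new coordinate, its constant term that of
    the remaining sum. A large weight makes both vanish. *)
Lemma separating_weights (I : finType) :
  exists2 q : I -> nat, forall i, (0 < q i)%N &
  forall x : 'I_k -> {ffun I -> 'I_k},
    similar (fun s => \sum_i (q i)%:Z *: f (x s i)) ->
    forall i, similar (fun s => f (x s i)).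
Proof.
suff H (l : seq I) : uniq l -> exists2 q : I -> nat, forall i, (0 < q i)%N &
  forall x : 'I_k -> {ffun I -> 'I_k},
    similar (fun s => \sum_(i <- l) (q i)%:Z *: f (x s i)) ->
    forall i, i \in l -> similar (fun s => f (x s i)).
  have [q q0 hq] := H _ (index_enum_uniq I); exists q => // x sx i.
  by apply: hq; rewrite ?mem_index_enum.
elim: l => [|a l IH] /=; first by exists (fun=> 1%N).
case/andP => al /IH [q q0 hq].
pose P := ({ffun 'I_k -> {ffun I -> 'I_k}} * ('I_k * 'I_k) * ('I_k * 'I_k))%type.
pose y (x : {ffun 'I_k -> {ffun I -> 'I_k}}) s := \sum_(i <- l) (q i)%:Z *: f (x s i).
pose dot (x : {ffun 'I_k -> {ffun I -> 'I_k}}) s t :=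
  2 * \sum_(i < d) (f (x s a) 0 i - f (x t a) 0 i) * (y x s 0 i - y x t 0 i).
pose F (p : P) := zsq (f p.2.1) (f p.2.2); pose G (p : P) := zsq (f p.1.2.1) (f p.1.2.2).
pose c2 (p : P) := zsq (f (p.1.1 p.1.2.1 a)) (f (p.1.1 p.1.2.2 a)) * F p
                 - zsq (f (p.1.1 p.2.1 a)) (f (p.1.1 p.2.2 a)) * G p.
pose c1 (p : P) := dot p.1.1 p.1.2.1 p.1.2.2 * F p - dot p.1.1 p.2.1 p.2.2 * G p.
pose c0 (p : P) := zsq (y p.1.1 p.1.2.1) (y p.1.1 p.1.2.2) * F p
                 - zsq (y p.1.1 p.2.1) (y p.1.1 p.2.2) * G p.
(* There are finitely many families and index pairs, so one [Q] exceeds the coefficients of all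
   these equations. *)
pose Q := (\sum_(p : P) (`|c2 p| + `|c1 p| + `|c0 p|)).+1%N.
have ltQ p : (`|c2 p| + `|c1 p| + `|c0 p| < Q)%N.
  by rewrite /Q ltnS (bigD1 p) //= leq_addr.
exists (fun i => if i == a then Q else q i) => [i|x sx]; first by case: ifP.
pose x' : {ffun 'I_k -> {ffun I -> 'I_k}} := [ffun s => x s].
have E s : \sum_(i <- a :: l) ((if i == a then Q else q i)%:Z *: f (x s i)) =
           Q%:Z *: f (x' s a) + y x' s.
  rewrite big_cons eqxx /x' ffunE; congr (_ + _); apply: eq_big_seq => i il.
  by rewrite ffunE; case: eqP => // ia; rewrite ia (negbTE al) in il.
have key s t s' t' : c2 (x', (s, t), (s', t')) = 0 /\ c0 (x', (s, t), (s', t')) = 0.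
  apply: (quadratic_zero (ltQ _)); have := sx s t s' t'; rewrite !E !zsq_scale_add.
  rewrite -/(dot x' s t) -/(dot x' s' t') => /eqP; rewrite -subr_eq0 => /eqP <-.
  by rewrite /c2 /c1 /c0 /F /G /=; ring.
move=> i; rewrite inE => /orP[/eqP ->|il].
  move=> s t s' t'; have [/eqP + _] := key s t s' t'.
  by rewrite /c2 subr_eq0 /F /G /= !ffunE => /eqP.
apply: (hq x) => // s t s' t'; have [_ /eqP] := key s t s' t'.
rewrite /c0 subr_eq0 /F /G /= => /eqP.
have yE s0 : y x' s0 = \sum_(i <- l) (q i)%:Z *: f (x s0 i).
  by apply: eq_bigr => j _; rewrite ffunE.
by rewrite !yE.
Qed.

Definition similar_free (Z : seq (lpt d)) :=
  forall z : 'I_k -> lpt d, (forall s, z s \in Z) -> similar z -> forall s t, z s = z t.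

(** The expected number of selected elements of [Y] is at least [mu] times the size of [Y], so some
    outcome attains this. *)
Lemma average_subset (R : realType) (T : eqType) (Om : finType) (sel : Om -> T -> bool)
    (Y : seq T) (mu : R) : (0 < #|Om|)%N ->
  (forall y, y \in Y -> mu * #|Om|%:R <= #|[set om | sel om y]|%:R) ->
  exists om, mu * (size Y)%:R <= (size [seq y <- Y | sel om y])%:R.
Proof.
move=> Om0 H; apply: contrapT => N.
have {}N om : (size [seq y <- Y | sel om y])%:R < mu * (size Y)%:R.
  by rewrite ltNge; apply/negP => h; apply: N; exists om.
have sums : (\sum_om (size [seq y <- Y | sel om y]) =
              \sum_(y <- Y) #|[set om | sel om y]|)%N.
  under eq_bigr do rewrite size_filter -sum1_count big_mkcond.
  rewrite exchange_big /=; apply: eq_bigr => y _.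
  by rewrite -sum1_card [RHS]big_mkcond; apply: eq_bigr => om _; rewrite inE.
have le1 : mu * (size Y)%:R * #|Om|%:R <= (\sum_(y <- Y) #|[set om | sel om y]|)%N%:R.
  rewrite natr_sum mulrAC -sum1_size natr_sum mulr_sumr [leLHS]big_seq [leRHS]big_seq.
  by apply: ler_sum => y yY; rewrite mulr1; apply: H.
have lt2 : (\sum_om (size [seq y <- Y | sel om y]))%N%:R < mu * (size Y)%:R * #|Om|%:R.
  rewrite natr_sum mulr_natr -sumr_const; have [om0 _] := card_gt0P Om0.
  apply: ltr_sum => [|om _]; last exact: N.
  by apply/hasP; exists om0; rewrite ?mem_index_enum.
by have := le_lt_trans le1; rewrite -sums => /(_ _ lt2); rewrite ltxx.
Qed.

Lemma sparse_lattice_block (R : realType) (r : nat) (mu : R) : (2 < k)%N ->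
  mu < (k%:R - 1) / k%:R ->
  exists S : seq (lpt d),
    (forall c : lpt d -> 'I_r, exists (v : lpt d) (lam : nat) (col : 'I_r),
       (0 < lam)%N /\
       forall s, v + lam%:Z *: f s \in S /\ c (v + lam%:Z *: f s) = col) /\
    (forall Y, uniq Y -> {subset Y <= S} -> exists Z,
       [/\ uniq Z, {subset Z <= Y}, similar_free Z & mu * (size Y)%:R <= (size Z)%:R]).
Proof.
move=> k3 hmu.
have [I [X [Om [vec [sel [ram ind [Om0 dens]]]]]]] := sparse_word_system r k3 hmu.
have [q q0 hq] := separating_weights I.
pose pi (w : {ffun I -> 'I_k}) : lpt d := \sum_i (q i)%:Z *: f (w i).
have k0 : (0 < k)%N by lia.
exists [seq pi (vec x) | x <- enum X]; split.
  move=> c; have [l [a [[i0 ai0] la lc]]] := ram (c \o pi).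
  (* The fixed letters of the line give the translation, and the weights of its active coordinates
     add up to the dilation factor. *)
  exists (\sum_(i | ~~ active a i) (q i)%:Z *: f (odflt (Ordinal k0) (a i))).
  exists (\sum_(i | active a i) q i)%N, (c (pi (vec (l (Ordinal k0))))).
  split; first by rewrite (bigD1 i0) //= ltn_addr.
  move=> s.
  have -> : \sum_(i | ~~ active a i) (q i)%:Z *: f (odflt (Ordinal k0) (a i)) +
            (\sum_(i | active a i) q i)%N%:Z *: f s = pi (vec (l s)).
    rewrite la /pi [RHS](bigID (active a)) /= addrC; congr (_ + _).
      by apply: eq_bigr => i; rewrite /active ffunE; case: (a i).
    rewrite -natz natr_sum scaler_suml; apply: eq_bigr => i; rewrite natz /active ffunE.
    by case: (a i).
  by split; [apply: map_f; rewrite mem_enum|exact: lc].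
move=> Y uY sYS.
(* Selection of a lattice point is decided by one chosen preimage. *)
pose lab y := [pick x | pi (vec x) == y].
pose selY om y := if lab y is Some x then sel om x else false.
have labY y : y \in Y -> exists2 x, lab y = Some x & pi (vec x) = y.
  move=> /sYS /mapP[x _ e]; rewrite /lab; case: pickP => [x' /eqP|/(_ x)]; first by exists x'.
  by rewrite e eqxx.
have [|om Hom] := @average_subset R _ _ selY Y mu Om0.
  by move=> y /labY [x e _]; rewrite /selY e.
exists [seq y <- Y | selY om y]; split=> //.
- exact: filter_uniq.
- exact: mem_subseq (filter_subseq _ _).
move=> z zZ simz.
have /choice[x Hx] : forall s, exists x, pi (vec x) = z s /\ sel om x.
  move=> s; have := zZ s; rewrite mem_filter => /andP[+ /labY [x e pe]].
  by rewrite /selY e => h; exists x.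
(* By the choice of the weights similarity passes to every coordinate, so a similar family comes
   from a quasiline. *)
have {}simz : forall i, const_or_inj (fun s => vec (x s) i).
  have /hq H : similar (fun s => pi (vec (x s))).
    by congr similar: simz; apply/funext => s; rewrite (Hx s).1.
  move=> i; case: (similar_const_or_inj (H i)) => [cst|I'].
    by left=> s t; apply: f_inj; apply: cst.
  by right=> s t e; apply: I'; rewrite e.
case: (pselect (exists i s t, vec (x s) i <> vec (x t) i)) => [ne|cst].
  by have [s] := ind om x simz ne; rewrite (Hx s).2.
move=> s t; rewrite -(Hx s).1 -(Hx t).1; congr pi; apply/ffunP => i.
by apply: contrapT => ne; apply: cst; exists i, s, t.
Qed.

End Similarity.

(** * Placing the finite blocks far apart *)

(** Block [r] will lie within [b r] of [A * cluster_base A b r] in each coordinate; the recursion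
    keeps all earlier blocks below [cluster_base A b r]. *)
Fixpoint cluster_base (A : nat) (b : nat -> nat) (r : nat) : nat :=
  if r is r'.+1 then (A * cluster_base A b r' + b r' + b r + 1)%N else (b 0 + 1)%N.

Lemma cluster_base_bound A b r : (b r < cluster_base A b r)%N.
Proof. by case: r => [|r] /=; lia. Qed.

Lemma cluster_base_lt A b t r : (0 < A)%N -> (t < r)%N ->
  (A * cluster_base A b t + b t < cluster_base A b r)%N.
Proof.
move=> A0; elim: r => // r IH; rewrite ltnS leq_eqVlt => /orP[/eqP ->|/IH h] /=; first lia.
by apply: leq_trans h _; nia.
Qed.

Section Clusters.
Variables (d k : nat) (f : 'I_k -> lpt d).
Hypotheses (k3 : (2 < k)%N) (d0 : (0 < d)%N) (f_inj : injective f).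

(** If both sides occurred, a pair across would have squared distance at least [((A - 2) P)^2], and
    some pair on one side at most [4 d P^2]. Similarity bounds the ratio by [C], distinct lattice
    points having squared distance at least 1; so [(A - 2)^2 <= 4 d C], against the choice of
    [A]. *)
Lemma clusters_apart (P : nat) (A C : int) (far : 'I_k -> bool) (z : 'I_k -> lpt d) :
  (0 < P)%N -> 0 <= C -> (forall s t, zsq (f s) (f t) <= C) -> A = 4 * d%:Z * C + 4 ->
  similar f z ->
  (forall s i, if far s then A * P%:Z - P%:Z <= z s 0 i <= A * P%:Z + P%:Z
               else 0 <= z s 0 i <= P%:Z) ->
  forall s t, far s = far t.
Proof.
move=> P0 C0 hC hA sim bnd.
have near s t : far s = far t -> zsq (z s) (z t) <= d%:Z * (2 * P%:Z) ^+ 2.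
  move=> e; apply: zsq_ub => i; have := bnd s i; have := bnd t i; rewrite e.
  by case: (far t); lia.
suff key s t : far s -> ~~ far t -> False.
  move=> s t; case: (boolP (far s)) (boolP (far t)) => [h|h] [h'|h'] //.
    by case: (key s t).
  by case: (key t s).
move=> fs nft.
have cross : ((A - 2) * P%:Z) ^+ 2 <= zsq (z s) (z t).
  apply: le_trans (zsq_coord _ _ (Ordinal d0)).
  have := bnd s (Ordinal d0); have := bnd t (Ordinal d0); rewrite fs (negbTE nft).
  move: (z s _ _) (z t _ _) => a b h1 h2.
  have h3 : (A - 2) * P%:Z <= a - b by lia.
  by apply: lerXn2r; rewrite ?nnegrE //; [nia|nia].
have [x xs xt] := third_index k3 s t.
(* This is where [k >= 3] enters: a third point shares its side with [s] or [t]. *)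
have [y [y' [ny ey]]] : exists y y', y != y' /\ far y = far y'.
  case: (boolP (far x)) => fx; first by exists x, s; rewrite fx fs.
  by exists x, t; rewrite (negbTE fx) (negbTE nft).
have f1 : 1 <= zsq (f y) (f y') by apply: zsq_ge1; rewrite (inj_eq f_inj).
have h1 := near _ _ ey; have := sim s t y y'; have h2 := hC s t.
have h0 := zsq_ge0 (f s) (f t); have h0' := zsq_ge0 (z y) (z y').
have P1 : 1 <= P%:Z by lia.
move: (zsq (z s) (z t)) (zsq (f y) (f y')) (zsq (z y) (z y')) (zsq (f s) (f t))
  cross f1 h1 h2 h0 h0' => a b c e cross f1 h1 h2 h0 h0' eq.
have i1 : a <= a * b by nia.
have i2 : c * e <= d%:Z * (2 * P%:Z) ^+ 2 * C by apply: ler_pM.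
have i3 : ((A - 2) * P%:Z) ^+ 2 <= d%:Z * (2 * P%:Z) ^+ 2 * C by lia.
have pos : 0 < P%:Z ^+ 2 by rewrite exprn_gt0.
have i4 : (A - 2) ^+ 2 <= 4 * d%:Z * C.
  rewrite -(ler_pM2r pos); apply: le_trans (le_trans i3 _); first by rewrite exprMn.
  by rewrite le_eqVlt; apply/orP; left; apply/eqP; ring.
have D0 : 0 <= 4 * d%:Z * C by rewrite !mulr_ge0.
by move: D0 i4; rewrite hA; move: (4 * d%:Z * C) => D D0; nia.
Qed.

End Clusters.

Lemma embed_sqdist (R : realType) d (x y : lpt d) : sqdist (embed R x) (embed R y) = (zsq x y)%:~R.
Proof.
by rewrite /sqdist /zsq rmorph_sum; apply: eq_bigr => i _; rewrite !mxE rmorphXn rmorphB.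
Qed.

(** A congruent copy of [lam F] multiplies all squared distances by [lam ^+ 2], hence is a similar
    family; it is not constant since [lam] is nonzero and [F] has two distinct points. *)
Lemma similar_free_F_free (R : realType) (d k : nat) (F Z : seq (lpt d)) :
  uniq F -> size F = k -> (2 < k)%N ->
  similar_free (fun s : 'I_k => nth 0 F s) Z -> F_free R F Z.
Proof.
move=> uF sF k3 free [lam [g [lam0 [giso H]]]].
pose f (s : 'I_k) := nth 0 F s.
have /choice[z Hz] : forall s : 'I_k, exists z, z \in Z /\ embed R z = g (lam *: embed R (f s)).
  by move=> s; have [|z zZ e] := H (f s); [rewrite mem_nth // sF|exists z].
have dist s t : (zsq (z s) (z t))%:~R = lam ^+ 2 * (zsq (f s) (f t))%:~R :> R.
  rewrite -!embed_sqdist (Hz s).2 (Hz t).2 giso /sqdist mulr_sumr.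
  by apply: eq_bigr => i _; rewrite !mxE -mulrBr exprMn.
have sim : similar f z.
  move=> s t s' t'; apply: (@intr_inj R); rewrite !rmorphM /= !dist; ring.
have k0 : (0 < k)%N by lia.
have k1 : (1 < k)%N by lia.
have := dist (Ordinal k0) (Ordinal k1); rewrite (free z (fun s => (Hz s).1) sim _ (Ordinal k1)).
move=> /esym /eqP; rewrite (_ : zsq (z _) (z _) = 0); last by apply/eqP; rewrite zsq_eq0.
rewrite mulf_eq0 sqrf_eq0 (negbTE lam0) /= intr_eq0 zsq_eq0 nth_uniq // sF //.
Qed.

Theorem theorem1p5 (R : realType) (d : nat) (F : seq (lpt d)) (k : nat) (mu : R) :
  (1 <= d)%N -> uniq F -> size F = k -> (3 <= k)%N ->
  0 < mu -> mu < (k%:R - 1) / k%:R ->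
  exists X : lpt d -> Prop,
    (forall x, X x -> forall i : 'I_d, 0 <= x 0 i) /\
    (forall r : nat, (1 <= r)%N -> forall c : lpt d -> 'I_r,
        mono_homothetic_copy F X c) /\
    (forall Y : seq (lpt d), uniq Y -> (forall y, y \in Y -> X y) ->
       exists Z : seq (lpt d),
         [/\ uniq Z, {subset Z <= Y}, F_free R F Z & mu * (size Y)%:R <= (size Z)%:R]).
Proof.
move=> d0 uF sF k3 mu0 hmu.
pose f (s : 'I_k) := nth 0 F s.
have f_inj : injective f.
  by move=> s t /eqP; rewrite nth_uniq ?sF // => /eqP /val_inj.
have /choice[S HS] := fun r => @sparse_lattice_block d k f f_inj R r mu k3 hmu.
pose b r := (\sum_(x <- S r) \sum_(i < d) `|x 0%R i|)%N.
have hb r x i : x \in S r -> (`|x 0%R i| <= b r)%N.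
  move=> xS; rewrite /b (big_rem x xS) /=; apply: leq_trans (leq_addr _ _).
  by rewrite (bigD1 i) //= leq_addr.
pose C : nat := (\sum_(s < k) \sum_(t < k) `|zsq (f s) (f t)|)%N.
have hC s t : zsq (f s) (f t) <= C%:Z.
  apply: le_trans (_ : (`|zsq (f s) (f t)|%N)%:Z <= _); first by lia.
  by rewrite lez_nat /C (bigD1 s) //= (bigD1 t) //= -addnA leq_addr.
(* The separation constant of [clusters_apart], with [C] bounding all squared distances within
   [F]. *)
pose A := (4 * d * C + 4)%N.
have A0 : (0 < A)%N by rewrite /A; lia.
pose P := cluster_base A b.
pose base r : lpt d := const_mx (A * P r)%N%:Z.
have bP r : (b r < P r)%N by apply: cluster_base_bound.
have Pmono t r : (t < r)%N -> (A * P t + b t < P r)%N by apply: cluster_base_lt.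
have coord r (x : lpt d) i : x - base r \in S r ->
    (A * P r)%N%:Z - (b r)%:Z <= x 0 i <= (A * P r)%N%:Z + (b r)%:Z.
  move=> /(hb _ _ i); rewrite !mxE.
  by move: (x 0 i) (A * P r)%N (b r) => a c e; lia.
pose X x := exists r, x - base r \in S r.
exists X; split; last split.
- move=> x [r xr] i; have := coord r x i xr; have := bP r; nia.
- move=> r _ c; have [v [lam [col [lam0 H]]]] := (HS r).1 (fun x => c (x + base r)).
  exists (v + base r), lam, col; split=> // x xF.
  have ltx : (index x F < k)%N by rewrite -sF index_mem.
  have := H (Ordinal ltx); rewrite /f /= nth_index // => -[h1 h2].
  by rewrite addrAC; split=> //; exists r; rewrite addrK.
move=> Y uY YX.
(* Each point of [Y] is assigned to one block containing it; the value 0 outside [Y] is a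
   default. *)
have /choice[rho Hrho] : forall y, exists r, y \in Y -> y - base r \in S r.
  by move=> y; case: (boolP (y \in Y)) => [/YX[r h]|_]; [exists r|exists 0%N].
pose Yr r := [seq y - base r | y <- Y & rho y == r].
have uYr r : uniq (Yr r).
  by rewrite map_inj_uniq ?filter_uniq //; apply: addIr.
have YrS r : {subset Yr r <= S r}.
  by move=> _ /mapP[y + ->]; rewrite mem_filter => /andP[/eqP <- /Hrho].
have /choice[Zr HZ] := fun r => (HS r).2 (Yr r) (uYr r) (YrS r).
pose Z := [seq y <- Y | y - base (rho y) \in Zr (rho y)].
exists Z; split.
- exact: filter_uniq.
- exact: mem_subseq (filter_subseq _ _).
- apply: (similar_free_F_free uF sF k3) => z zZ sim.
  have zY s : z s \in Y by have := zZ s; rewrite mem_filter => /andP[].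
  have zS s := Hrho _ (zY s).
  have zZr s : z s - base (rho (z s)) \in Zr (rho (z s)).
    by have := zZ s; rewrite mem_filter => /andP[].
  have k0 : (0 < k)%N by lia.
  have [m _ hm] : exists2 m : 'I_k, true & forall s, (rho (z s) <= rho (z m))%N.
    case: (arg_maxnP (fun s => rho (z s)) (erefl : xpredT (Ordinal k0))) => m _ h.
    by exists m => // s; apply: h.
  (* Points assigned to the largest block index are far; by [Pmono] all the others have coordinates
     between 0 and [P (rho (z m))]. *)
  have eqr s : rho (z s) = rho (z m).
    pose far s := rho (z s) == rho (z m).
    suff : far s = far m by rewrite /far eqxx => /eqP.
    apply: (@clusters_apart d k f k3 d0 f_inj (P (rho (z m))) A%:Z C%:Z far z) => //.
      by have := bP (rho (z m)); lia.
    move=> t i; have := coord _ _ i (zS t); have := bP (rho (z m)); have := bP (rho (z t)).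
    rewrite /far; case: eqVneq => [->|ne]; first by lia.
    have := Pmono (rho (z t)) (rho (z m)); rewrite ltn_neqAle hm ne => /(_ isT).
    by nia.
  have [_ _ free _] := HZ (rho (z m)).
  move=> s t; apply: (addIr (- base (rho (z m)))).
  apply: (free (fun s => z s - base (rho (z m)))); last by apply/similar_add.
  by move=> s'; rewrite -(eqr s').
(* The density bound is summed over the blocks: [g] colours the points by their block index, and [N]
   bounds the indices that occur. *)
- pose N := (\max_(y <- Y) rho y)%N.
  pose g y : 'I_N.+1 := inord (rho y).
  have vg y : y \in Y -> g y = rho y :> nat.
    by move=> yY; rewrite inordK // ltnS /N; apply: (leq_bigmax_seq _ yY).
  rewrite -(sum_count_color g Y) -(sum_count_color g Z) !natr_sum mulr_sumr.
  apply: ler_sum => r _; have [uZr sZr _ hZr] := HZ r.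
  have gE y : y \in Y -> (g y == r) = (rho y == r).
    by move=> yY; rewrite -(vg y yY).
  have -> : count (fun x => g x == r) Y = size (Yr r).
    by rewrite size_map size_filter; apply: eq_in_count => y /gE.
  apply: le_trans hZr _; rewrite ler_nat -size_filter -[leqRHS](size_map (fun y => y - base r)).
  apply: uniq_leq_size => // y yZ; have /mapP[y' + e] := sZr y yZ.
  rewrite mem_filter => /andP[/eqP ry y'Y]; apply/mapP; exists y' => //.
  by rewrite !mem_filter gE // ry eqxx -e yZ.
Qed.
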